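(* Let $d>2$ be an integer, let $\mathbb{K}$ be a field whose characteristic does not divide $d!$ and which contains a primitive $d$-th root of unity $\omega$, let $V$ be a vector space over $\mathbb{K}$, and let $\sigma\in S_d$ be a $d$-cycle. For $k\in\{1,\dots,d-1\}$ put $$W^k_{(d-1,1)}(V,\mathbb{K})=\{F\in W_{(d-1,1)}(V,\mathbb{K}) : \sigma F=\omega^k F\}.$$ Then there is a direct sum decomposition $$W_{(d-1,1)}(V,\mathbb{K})=\bigoplus_{i=1}^{d-1}W^i_{(d-1,1)}(V,\mathbb{K}).$$
   Context: Let $C^d(V,\mathbb{K})$ be the space of multilinear forms $F\colon V\times\cdots\times V\to\mathbb{K}$ ($d$ factors). The symmetric group $S_d$ acts on it by $(\tau F)(x_1,\dots,x_d)=F(x_{\tau(1)},\dots,x_{\tau(d)})$. Let $V_{(d-1,1)}$ be the standard irreducible representation of $S_d$ over $\mathbb{K}$, i.e. the hyperplane $\{(x_1,\dots,x_d)\in\mathbb{K}^d : x_1+\cdots+x_d=0\}$ with $S_d$ permuting coordinates. $W_{(d-1,1)}(V,\mathbb{K})$ denotes the $V_{(d-1,1)}$-isotypic component of $C^d(V,\mathbb{K})$, i.e. the sum of all subrepresentations of $C^d(V,\mathbb{K})$ isomorphic to $V_{(d-1,1)}$. *)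

(* Defs.v *)
From HB Require Import structures.
From mathcomp Require Import all_boot all_order all_algebra all_fingroup.
From mathcomp Require Import boolp classical_sets functions.

Set Implicit Arguments.
Unset Strict Implicit.
Unset Printing Implicit Defensive.

Import GRing.Theory.
Local Open Scope ring_scope.
Local Open Scope classical_set_scope.

Section LinearAlgebra.
Variables (K : fieldType) (M : lmodType K).

Definition is_subspace (U : set M) : Prop := submod_closed [in U].

(* The empty sum (n = 0) is allowed, so the sum of no subspace is 0. *)
Definition sum_of_subspaces (P : set (set M)) : set M :=
  [set x | exists (n : nat) (y : 'I_n -> M),
    (forall i, exists2 U, P U & U (y i)) /\ x = \sum_(i < n) y i].

Definition is_internal_direct_sum (I : finType) (W : set M) (E : I -> set M) :
    Prop :=
  [/\ forall i, is_subspace (E i),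
      W = [set x | exists2 f : I -> M,
                     forall i, E i (f i) & x = \sum_i f i] &
      forall f : I -> M, (forall i, E i (f i)) ->
        \sum_i f i = 0 -> forall i, f i = 0].

End LinearAlgebra.

Section Representations.
Variables (K : fieldType) (G : Type).

Definition is_subrep (M : lmodType K) (act : G -> M -> M) (A U : set M) :
    Prop :=
  [/\ is_subspace U, U `<=` A & forall g x, U x -> U (act g x)].

Definition rep_isomorphic (M N : lmodType K) (actM : G -> M -> M)
    (actN : G -> N -> N) (A : set M) (B : set N) : Prop :=
  exists phi : M -> N,
    [/\ set_bij A B phi,
        forall a x y, A x -> A y -> phi (a *: x + y) = a *: phi x + phi y &
        forall g x, A x -> phi (actM g x) = actN g (phi x)].

(* A and B are the representation spaces, as invariant subspaces of the
   ambient modules M and N. *)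
Definition isotypic_component (M N : lmodType K) (actM : G -> M -> M)
    (actN : G -> N -> N) (A : set M) (B : set N) : set N :=
  sum_of_subspaces
    [set U | is_subrep actN B U /\ rep_isomorphic actM actN A U].

End Representations.

Section MultilinearForms.
Variables (K : fieldType) (V : lmodType K) (d : nat).

Local Notation form := ({ffun 'I_d -> V} -> K^o).

Definition multilinear_forms : set form :=
  [set F | forall (i : 'I_d) (x : {ffun 'I_d -> V}),
    scalar (fun v : V => F [ffun j => if j == i then v else x j])].

Definition perm_form (t : 'S_d) (F : form) : form :=
  fun x => F [ffun i => x (t i)].

Definition std_rep : set 'rV[K]_d := [set x | \sum_i x 0 i = 0].

(* t sends the i-th basis vector to the (t i)-th one.  The inverse is needed
   for this to be an action on the same side as perm_form, which is a left
   action for the usual composition of permutations. *)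
Definition perm_coord (t : 'S_d) (x : 'rV[K]_d) : 'rV[K]_d :=
  col_perm t^-1%g x.

Definition W_std : set form :=
  isotypic_component perm_coord perm_form std_rep multilinear_forms.

Definition W_std_eigen (s : 'S_d) (w : K) (k : nat) : set form :=
  [set F | W_std F /\ perm_form s F = w ^+ k *: F].

End MultilinearForms.

Definition is_full_cycle (d : nat) (s : 'S_d) : Prop :=
  exists a : d.-tuple 'I_d, ufcycle s a.

(* Main.v *)
Require Import Defs.
From HB Require Import structures.
From mathcomp Require Import all_boot all_order all_algebra all_fingroup.
From mathcomp Require Import boolp classical_sets functions.

Set Implicit Arguments.
Unset Strict Implicit.
Unset Printing Implicit Defensive.

Import GRing.Theory.
Local Open Scope ring_scope.

(** The idea is that a [d]-cycle [s] satisfies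
    [1 + s + ... + s^(d-1) = 0] on the standard representation: the [i]-th
    coordinate of [x + s x + ... + s^(d-1) x] is the sum of the coordinates of
    [x] along the orbit of [i], which is everything, hence [0].  This relation
    is transported to every copy of the standard representation and then to
    their sum, the isotypic component [W] ([sum_iter_W_std]).

    The rest is linear algebra ([eigenspace_decomposition]).  Let [T] be an
    endomorphism with [1 + T + ... + T^(d-1) = 0] on an invariant subspace [W];
    then [T^d = 1] on [W].  For a [d]-th root of unity [z], the sum
    [e_z = \sum_(j < d) z^-j T^j] maps [W] into the [z]-eigenspace.  It
    annihilates the eigenspaces of the other [d]-th roots of unity and is the
    multiplication by [d], which is invertible in [K], on the [z]-eigenspace;
    so the eigenspaces are independent.  The sum of the [e_z] over all [z] is
    [d], and [e_1 = 0] on [W] by assumption; so the eigenspaces for [z != 1]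
    span [W]. *)

(** * Eigenspaces of an operator annihilated by 1 + T + ... + T^(d-1) *)

Lemma sum_unity_root_eq0 (R : idomainType) (n : nat) (z : R) :
  z ^+ n = 1 -> z != 1 -> \sum_(j < n) z ^+ j = 0.
Proof.
move=> zn1 z_neq1; have /eqP := subrX1 z n.
by rewrite zn1 subrr eq_sym mulf_eq0 subr_eq0 (negPf z_neq1) => /eqP.
Qed.

Lemma sum_ord_shift (R : nmodType) (g : nat -> R) (n : nat) :
  g 0%N + \sum_(j < n) g j.+1 = \sum_(j < n) g j + g n.
Proof. by rewrite -[RHS](big_ord_recr n (fun i : 'I_n.+1 => g i)) big_ord_recl. Qed.

Section EigenProjector.
Variables (K : fieldType) (M : lmodType K) (T : {linear M -> M}).

Lemma iter_linearP (j : nat) : linear (iter j T).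
Proof. by elim: j => [|j IHj] a x y //=; rewrite IHj linearP. Qed.

HB.instance Definition _ (j : nat) :=
  GRing.isLinear.Build K M M _ (iter j T) (iter_linearP j).

Lemma iter_eigenvector (z : K) (x : M) (j : nat) :
  T x = z *: x -> iter j T x = z ^+ j *: x.
Proof.
move=> Tx; elim: j => [|j IHj] /=; first by rewrite expr0 scale1r.
by rewrite IHj linearZ /= Tx scalerA exprSr.
Qed.

(** When [z ^+ d = 1], this is [d] times the projector onto the
    [z]-eigenspace of [T], on the vectors fixed by [T^d]. *)
Definition eigen_projector (d : nat) (z : K) (x : M) : M :=
  \sum_(j < d) z^-1 ^+ j *: iter j T x.

Lemma eigen_projectorP (d : nat) (z : K) (x : M) :
  z != 0 -> z ^+ d = 1 -> iter d T x = x ->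
  T (eigen_projector d z x) = z *: eigen_projector d z x.
Proof.
move=> z_neq0 zd1 Tdx; rewrite linear_sum scaler_sumr /=.
pose g j := z *: (z^-1 ^+ j *: iter j T x).
transitivity (\sum_(j < d) g j.+1).
  apply: eq_bigr => j _.
  by rewrite /g linearZ /= scalerA exprS mulrA mulfV // mul1r.
(* The range is shifted by one, which is harmless since g d = g 0 *)
apply: (addrI (g 0%N)).
rewrite sum_ord_shift addrC.
by rewrite /g Tdx exprVn zd1 invr1.
Qed.

Lemma eigen_projector_sum (d : nat) (w : K) (x : M) :
  d.-primitive_root w ->
  \sum_(k < d) eigen_projector d (w ^+ k) x = d%:R *: x.
Proof.
move=> w_prim; have d_gt0 := prim_order_gt0 w_prim.
rewrite exchange_big (bigD1 (Ordinal d_gt0)) //=.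
rewrite [X in X + _](eq_bigr (fun=> x)) => [|k _]; last first.
  by rewrite expr0 scale1r.
rewrite sumr_const card_ord scaler_nat big1 ?addr0 // => j j_neq0.
rewrite -scaler_suml (eq_bigr (fun k : 'I_d => (w ^- j) ^+ k)) => [|k _].
  rewrite sum_unity_root_eq0 ?scale0r //.
    by rewrite exprVn -exprM mulnC exprM (prim_expr_order w_prim) expr1n invr1.
  rewrite invr_eq1 -(expr0 w) (eq_prim_root_expr w_prim) eqn_mod_dvd // subn0.
  by rewrite gtnNdvd // lt0n.
by rewrite !exprVn -!exprM mulnC.
Qed.

Lemma eigen_projector_eigenvector (d : nat) (y z : K) (x : M) :
  z != 0 -> y ^+ d = 1 -> z ^+ d = 1 -> T x = y *: x ->
  eigen_projector d z x = if y == z then d%:R *: x else 0.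
Proof.
move=> z_neq0 yd1 zd1 Tx.
have -> : eigen_projector d z x = (\sum_(j < d) (y / z) ^+ j) *: x.
  rewrite scaler_suml; apply: eq_bigr => j _.
  by rewrite (iter_eigenvector _ Tx) scalerA -exprMn mulrC.
have [->|y_neq_z] := eqVneq y z.
  rewrite divff //; congr (_ *: _).
  under eq_bigr do rewrite expr1n.
  by rewrite sumr_const card_ord.
rewrite sum_unity_root_eq0 ?scale0r //.
  by rewrite expr_div_n yd1 zd1 divr1.
by apply: contra y_neq_z => /eqP yz1; rewrite -[y](divfK z_neq0) yz1 mul1r.
Qed.

(** The eigenvalue [1] does not occur: on a vector fixed by [T], the vanishing
    sum is [d] times that vector. *)
Lemma eigenspace_decomposition (d : nat) (w : K) (W : set M) :
  d.-primitive_root w -> is_subspace W -> (forall x, W x -> W (T x)) ->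
  (forall x, W x -> \sum_(j < d) iter j T x = 0) ->
  is_internal_direct_sum W
    (fun i : 'I_d.-1 => [set x | W x /\ T x = w ^+ i.+1 *: x]%classic).
Proof.
case: d => [/prim_order_gt0 //|n] w_prim [].
rewrite in_setE => W0 WP WT Wsum; set d := n.+1 in w_prim Wsum *.
have WD a x y : W x -> W y -> W (a *: x + y).
  by move=> Wx Wy; have := WP a x y; rewrite !in_setE; apply.
have WZ a x : W x -> W (a *: x) by move=> Wx; rewrite -[_ *: _]addr0; apply: WD.
have Wbig (I : finType) (f : I -> M) : (forall i, W (f i)) -> W (\sum_i f i).
  move=> Wf; elim/big_rec: _ => // i x _ Wx.
  by rewrite -[f i]scale1r; apply: WD.
have Witer j x : W x -> W (iter j T x).
  by move=> Wx; elim: j => //= j /WT.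
have w_neq0 : w != 0.
  by have := oner_neq0 K; rewrite -(prim_expr_order w_prim) expf_eq0.
have wk_neq0 k : w ^+ k != 0 by rewrite expf_neq0.
have wkd k : (w ^+ k) ^+ d = 1.
  by rewrite -exprM mulnC exprM (prim_expr_order w_prim) expr1n.
have d_neq0 : d%:R != 0 :> K by apply: prim_root_natf_neq0 w_prim.
have Td x : W x -> iter d T x = x.
  move=> Wx; have := congr1 T (Wsum x Wx).
  rewrite linear0 linear_sum /= => sumT.
  have := sum_ord_shift (fun j => iter j T x) d.
  by rewrite Wsum //= sumT addr0 add0r.
split.
- move=> i; split=> [|a x y].
    by rewrite in_setE; split=> //; rewrite linear0 scaler0.
  rewrite !in_setE => -[Wx Tx] [Wy Ty]; split; first exact: WD.
  by rewrite linearP Tx Ty scalerDr !scalerA mulrC.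
- apply/seteqP; split=> x /= => [Wx | [f fE ->]]; last first.
    by apply: Wbig => i; case: (fE i).
  exists (fun i : 'I_n => d%:R^-1 *: eigen_projector d (w ^+ i.+1) x).
    move=> i; split.
      by apply/WZ/Wbig => j; apply/WZ/Witer.
    by rewrite linearZ /= eigen_projectorP ?Td // !scalerA mulrC.
  rewrite -scaler_sumr; apply: (scalerI d_neq0).
  rewrite scalerA divff // scale1r -(eigen_projector_sum x w_prim).
  (* The term k = 0, for the eigenvalue 1, vanishes by hypothesis *)
  rewrite big_ord_recl /= [X in X + _](_ : _ = 0) ?add0r //.
  rewrite -[RHS](Wsum x Wx); apply: eq_bigr => j _.
  by rewrite expr0 invr1 expr1n scale1r.
- move=> f fE f0 k; apply: (scalerI d_neq0); rewrite scaler0.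
  transitivity (\sum_i eigen_projector d (w ^+ k.+1) (f i)).
    rewrite (bigD1 k) //= big1 ?addr0 => [|i i_neq_k].
      have [_ Tk] := fE k.
      by rewrite (eigen_projector_eigenvector (y := w ^+ k.+1)) ?eqxx.
    have [_ Ti] := fE i.
    rewrite (eigen_projector_eigenvector (y := w ^+ i.+1)) //.
    rewrite (eq_prim_root_expr w_prim) !modn_small ?ltnS ?ltn_ord //.
    by rewrite eqSS val_eqE (negPf i_neq_k).
  rewrite exchange_big big1 //= => j _.
  by rewrite -scaler_sumr -linear_sum f0 linear0 scaler0.
Qed.

End EigenProjector.

(** * The isotypic component as an invariant subspace *)

Section Isotypic.
Variables (K : fieldType) (G : Type) (M N : lmodType K).
Variables (actM : G -> M -> M) (actN : G -> {linear N -> N}).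
Variables (A : set M) (B : set N).

Local Notation isoN := (isotypic_component actM (fun g => actN g : N -> N) A B).

Lemma isotypic_subspace : is_subspace isoN.
Proof.
split=> [|a x y]; rewrite !in_setE.
  by exists 0%N, (fun=> 0); split=> [[]//|]; rewrite big_ord0.
move=> [m [f [fP ->]]] [n [g [gP ->]]].
exists (m + n)%N,
  (fun i => match fintype.split i with inl j => a *: f j | inr j => g j end).
split=> [i|].
  case: (fintype.split i) => j; last exact: gP.
  have [U PU Uf] := fP j; exists U => //.
  have [[[U0 UP] _ _] _] := PU; have := UP a (f j) 0.
  by rewrite !in_setE addr0 in U0 *; apply.
rewrite big_split_ord scaler_sumr; congr (_ + _); apply: eq_bigr => i _.
  by rewrite (unsplitK (inl i)).
by rewrite (unsplitK (inr i)).
Qed.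

Lemma isotypic_invariant (g : G) (x : N) : isoN x -> isoN (actN g x).
Proof.
move=> [n [f [fP ->]]]; exists n, (fun i => actN g (f i)); split.
  move=> i; have [U PU Uf] := fP i; exists U => //.
  by have [[_ _ Uact] _] := PU; apply: Uact.
by rewrite linear_sum.
Qed.

(** A polynomial relation satisfied by [g] on the representation [A] also holds
    on the [A]-isotypic component, here for [1 + X + ... + X^(d-1)].  The
    isomorphisms are linear on [A] only, so [A] has to be a subspace, and an
    invariant one, for them to commute with the sum. *)
Lemma isotypic_sum_iter (g : G) (d : nat) :
  is_subspace A -> (forall x, A x -> A (actM g x)) ->
  (forall x, A x -> \sum_(j < d) iter j (actM g) x = 0) ->
  forall x, isoN x -> \sum_(j < d) iter j (actN g) x = 0.
Proof.
move=> [A0 AP] Aact Asum _ [n [f [fP ->]]].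
rewrite in_setE in A0.
under eq_bigr do rewrite linear_sum.
rewrite exchange_big big1 //= => i _.
have [U [_ [phi [[_ _ phi_surj] phiP phi_act]]] Uf] := fP i.
have [x Ax <-] := phi_surj _ Uf.
have phiD y z : A y -> A z -> phi (y + z) = phi y + phi z.
  by move=> Ay Az; have := phiP 1 _ _ Ay Az; rewrite !scale1r.
have phi0 : phi 0 = 0.
  by apply: (addrI (phi 0)); rewrite -phiD // !addr0.
have Aiter j : A (iter j (actM g) x) by elim: j => //= j /Aact.
have phi_iter j : iter j (actN g) (phi x) = phi (iter j (actM g) x).
  by elim: j => //= j ->; rewrite phi_act.
suff [_ <-] : A (\sum_(j < d) iter j (actM g) x) /\
    phi (\sum_(j < d) iter j (actM g) x)
      = \sum_(j < d) iter j (actN g) (phi x).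
  by rewrite Asum.
elim/big_rec2: _ => [//|j u v _ [Av <-]].
split; last by rewrite phiD // phi_iter.
have := AP 1 (iter j (actM g) x) v; rewrite !in_setE scale1r.
by apply.
Qed.

End Isotypic.

(** * Full cycles and the standard representation *)

Lemma full_cycle_order (d : nat) (s : 'S_d) (i : 'I_d) :
  is_full_cycle s -> fingraph.order s i = d.
Proof.
move=> [a /andP[a_cycle a_uniq]].
have a_card : #|a| = #|'I_d|.
  by rewrite (card_uniqP a_uniq) size_tuple card_ord.
rewrite (order_cycle a_cycle a_uniq) ?size_tuple //.
by rewrite (elimT (subset_cardP a_card) (subset_predT _)).
Qed.

Lemma order_permV (T : finType) (s : {perm T}) :
  fingraph.order (s^-1)%g =1 fingraph.order s.
Proof.
move=> x; rewrite -(order_finv (@perm_inj _ s)); apply/eq_card/eq_fconnect => y.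
by apply: (@perm_inj _ s); rewrite permKV f_finv //; apply: perm_inj.
Qed.

(** The orbit of any point under a full cycle, or its inverse, is everything.
    The inverse is the one occurring in [perm_coord]. *)
Lemma sum_full_cycle (d : nat) (s : 'S_d) (R : nmodType) (g : 'I_d -> R)
    (i : 'I_d) :
  is_full_cycle s -> \sum_(j < d) g (iter j (s^-1)%g i) = \sum_j g j.
Proof.
move=> s_cycle; have Vord : fingraph.order (s^-1)%g i = d.
  by rewrite order_permV full_cycle_order.
have orb_card : #|fingraph.orbit (s^-1)%g i| = #|'I_d|.
  by rewrite (card_uniqP (orbit_uniq _ _)) size_orbit card_ord.
have orb_perm : perm_eq (fingraph.orbit (s^-1)%g i) (index_enum 'I_d).
  apply: uniq_perm; rewrite ?orbit_uniq ?index_enum_uniq // => j.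
  by rewrite mem_index_enum (elimT (subset_cardP orb_card) (subset_predT _)).
rewrite -[RHS](perm_big _ orb_perm) [RHS](big_nth i) size_orbit Vord big_mkord.
by apply: eq_bigr => j _; rewrite /fingraph.orbit Vord nth_traject ?ltn_ord.
Qed.

Section StdRep.
Variables (K : fieldType) (d : nat).

Lemma std_rep_subspace : is_subspace (@std_rep K d).
Proof.
split=> [|a x y]; rewrite !in_setE /std_rep /=.
  by rewrite big1 // => i _; rewrite mxE.
move=> x0 y0; under eq_bigr do rewrite !mxE.
by rewrite big_split -mulr_sumr /= x0 y0 mulr0 addr0.
Qed.

Lemma std_rep_invariant (s : 'S_d) (x : 'rV[K]_d) :
  std_rep x -> std_rep (perm_coord s x).
Proof.
rewrite /std_rep /= => x0; under eq_bigr do rewrite mxE.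
by rewrite -[RHS]x0 [RHS](reindex_inj (@perm_inj _ s^-1%g)).
Qed.

Lemma sum_iter_std_rep (s : 'S_d) (x : 'rV[K]_d) :
  is_full_cycle s -> std_rep x -> \sum_(j < d) iter j (perm_coord s) x = 0.
Proof.
move=> s_cycle x0; apply/rowP => i; rewrite summxE mxE -[RHS]x0.
rewrite -(sum_full_cycle (x 0) i s_cycle); apply: eq_bigr => j _.
elim: {j}(j : nat) i => // j IHj i.
by rewrite iterS mxE IHj -iterSr.
Qed.

End StdRep.

(** * Action on the multilinear forms *)

Section Forms.
Variables (K : fieldType) (V : lmodType K) (d : nat).

Lemma perm_form_linear (s : 'S_d) : linear (@perm_form K V d s).
Proof. by []. Qed.

HB.instance Definition _ (s : 'S_d) :=
  GRing.isLinear.Build K ({ffun 'I_d -> V} -> K^o) ({ffun 'I_d -> V} -> K^o)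
    _ (perm_form s) (perm_form_linear s).

Lemma sum_iter_W_std (s : 'S_d) (F : {ffun 'I_d -> V} -> K^o) :
  is_full_cycle s -> W_std F -> \sum_(j < d) iter j (perm_form s) F = 0.
Proof.
move=> s_cycle.
apply: (isotypic_sum_iter (actN := fun t => @perm_form K V d t)).
- exact: std_rep_subspace.
- exact: std_rep_invariant.
- by move=> x; apply: sum_iter_std_rep.
Qed.

End Forms.

Theorem proposition3p5 (d : nat) (hd : (2 < d)%N) (K : fieldType)
    (hchar : forall p : nat, p \in [pchar K] -> ~~ (p %| d`!)%N)
    (omega : K) (homega : d.-primitive_root omega)
    (V : lmodType K) (sigma : 'S_d) (hsigma : is_full_cycle sigma) :
  is_internal_direct_sum (@W_std K V d)
    (fun i : 'I_d.-1 => @W_std_eigen K V d sigma omega i.+1).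
Proof.
apply: (eigenspace_decomposition (T := @perm_form K V d sigma)) => //.
- exact: (isotypic_subspace _ (fun t => @perm_form K V d t)).
- exact: (isotypic_invariant (actN := fun t => @perm_form K V d t)).
- by move=> F; apply: sum_iter_W_std.
Qed.
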